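(* For all integers $m,i$ with $1\leq i\leq m-1$, $$\frac{d_{i-1}^{2}(m)-d_{i-2}(m)d_{i}(m)}{d_{i}^{2}(m)-d_{i-1}(m)d_{i+1}(m)} < \frac{(i+1)(i+2)(m+i+3)^2}{(m+1-i)(m+2-i)(m+i+2)^{2}}.$$
   Context: For integers $m\ge 0$ and $0\le i\le m$, the Boros-Moll numbers are $$d_i(m)=2^{-2m}\sum_{k=i}^m 2^k\binom{2m-2k}{m-k}\binom{m+k}{k}\binom{k}{i},$$ with the convention $d_i(m)=0$ for $i<0$ or $i>m$. The notation $d_i^{2}(m)$ means $(d_i(m))^2$. *)

(* Defs.v *)
From mathcomp Require Import all_boot all_order all_algebra.

Set Implicit Arguments.
Unset Strict Implicit.
Unset Printing Implicit Defensive.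

Import Order.TTheory GRing.Theory Num.Theory.
Local Open Scope ring_scope.

(* Boros-Moll numbers d_i(m), with the index i ranging over int: the value is 0
   for i < 0 (the Negz branch) and for i > m (the sum is then empty). The
   truncated subtractions on nat are exact because k <= m throughout. *)
Definition boros_moll (i : int) (m : nat) : rat :=
  match i with
  | Posz j =>
      2 ^- (2 * m) *
      \sum_(j <= k < m.+1)
        2 ^+ k * 'C(2 * m - 2 * k, m - k)%:R * 'C(m + k, k)%:R * 'C(k, j)%:R
  | Negz _ => 0
  end.

(* Main.v *)
(* For fixed [m], creative telescoping gives a three-term recurrence in [i]
   expressing [d_{i-2}] and [d_{i+1}] through [d_{i-1}] and [d_i], so both sides
   of the claim become quadratic forms in [d_{i-1}, d_i]. Write
   [i d_i / d_{i-1} = (m - i + 1) (1 - 1 / (2 i + 1 + c_i))]. The denominator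
   of the left-hand side is then visibly positive for [c_i >= 0], and the
   claim follows from [0 <= c_i <= 3 (m - i) / (2 i)], which is
   proved by backward induction from [c_m = 0] along the recurrence. The witness
   [r >= 0] below encodes this bound as [c_i = 3 (m - i) / (2 i + r)]. *)

Require Import Defs.
From mathcomp Require Import all_boot all_order all_algebra.
From mathcomp Require Import ring lra zify.

Set Implicit Arguments.
Unset Strict Implicit.
Unset Printing Implicit Defensive.

Import Order.TTheory GRing.Theory Num.Theory.
Local Open Scope ring_scope.

(** * Weights of the defining sum *)

Lemma central_bin_rec (n : nat) :
  (n.+1 * 'C(2 * n.+1, n.+1) = 2 * (2 * n).+1 * 'C(2 * n, n))%N.
Proof.
have h1 := mul_bin_diag (2 * n.+1) n.
have h2 := mul_bin_down (2 * n).+1 n.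
rewrite -h1 (_ : (2 * n.+1).-1 = (2 * n).+1)%N; last lia.
rewrite (_ : ((2 * n).+1 - n = n.+1)%N) /= in h2; last lia.
by rewrite -!mulnA h2.
Qed.

Definition bm_weight (m k : nat) : rat :=
  2 ^+ k * 'C(2 * m - 2 * k, m - k)%:R * 'C(m + k, k)%:R.

(** Consecutive weights have a quotient rational in [k], which is what makes telescoping in [k]
    possible. *)
Lemma bm_weight_rec (m k : nat) : (k < m)%N ->
  (2 * m%:R - 2 * k%:R - 1) * (k%:R + 1) * bm_weight m k.+1
    = (m%:R - k%:R) * (m%:R + k%:R + 1) * bm_weight m k.
Proof.
move=> ltkm; have [n ->] : exists n, m = (k + n.+1)%N by exists (m - k.+1)%N; lia.
rewrite /bm_weight.
rewrite (_ : 2 * (k + n.+1) - 2 * k = 2 * n.+1)%N; last lia.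
rewrite (_ : 2 * (k + n.+1) - 2 * k.+1 = 2 * n)%N; last lia.
rewrite (_ : (k + n.+1) - k = n.+1)%N; last lia.
rewrite (_ : (k + n.+1) - k.+1 = n)%N; last lia.
rewrite (addnS (k + n.+1) k).
have h1 := central_bin_rec n.
have h2 : ((k + n.+1 + k).+1 * 'C(k + n.+1 + k, k)
           = k.+1 * 'C((k + n.+1 + k).+1, k.+1))%N := mul_bin_diag _ k.
move: h1 h2; set X := 'C(_, n.+1); set Y := 'C(2 * n, n).
set Z := 'C(_, k); set T := 'C(_, k.+1); move: X Y Z T => X Y Z T.
move=> /(congr1 (fun z => z%:R : rat)) h1 /(congr1 (fun z => z%:R : rat)) h2.
rewrite !(natrM, mulrS, natrD) in h1 h2; rewrite !(mulrS, natrD) exprS.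
transitivity ((2 : rat) ^+ k * (2 * (1 + 2 * n%:R) * Y%:R) * ((1 + k%:R) * T%:R)).
  by ring.
transitivity ((2 : rat) ^+ k * ((1 + n%:R) * X%:R) * ((1 + (k%:R + (1 + n%:R) + k%:R)) * Z%:R)).
  by rewrite h1 h2; ring.
by ring.
Qed.

Lemma bm_weight_gt0 (m k : nat) : (k <= m)%N -> 0 < bm_weight m k.
Proof.
by move=> lekm; rewrite !mulr_gt0 ?exprn_gt0 ?ltr0n ?bin_gt0 //; lia.
Qed.

(** The added terms have [k < j], so ['C(k, j) = 0]. The range no longer depends on [j], so sums for
    different [j] combine termwise. *)
Lemma boros_mollE (m j : nat) :
  boros_moll j m = 2 ^- (2 * m) * \sum_(0 <= k < m.+1) bm_weight m k * 'C(k, j)%:R.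
Proof.
rewrite /=; congr (_ * _); have [lejm|ltmj] := leqP j m.+1; last first.
  rewrite big_geq; last exact: ltnW.
  rewrite big_nat big1 // => k /andP[_ ltkm].
  by rewrite bin_small ?mulr0 //; apply: ltn_trans ltmj.
rewrite [RHS](big_cat_nat (leq0n j) lejm) /= [X in _ = X + _]big_nat.
rewrite [X in _ = X + _]big1 ?add0r // => k /andP[_ ltkj].
by rewrite bin_small // mulr0.
Qed.

Arguments boros_moll : simpl never.

Lemma boros_moll_gt0 (m j : nat) : (j <= m)%N -> 0 < boros_moll j m.
Proof.
move=> lejm; rewrite boros_mollE mulr_gt0 ?invr_gt0 ?exprn_gt0 //.
rewrite big_nat_recr //= ltr_wpDl //.
  rewrite big_nat sumr_ge0 // => k /andP[_ ltkm].
  by rewrite mulr_ge0 // ltW // bm_weight_gt0 // ltnW.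
by rewrite mulr_gt0 ?bm_weight_gt0 // ltr0n bin_gt0.
Qed.

Lemma boros_moll_gtm (m : nat) : boros_moll m.+1 m = 0.
Proof. by rewrite /boros_moll big_geq // mulr0. Qed.

(** * Three-term recurrence in [j] at fixed [m] *)

Lemma mul_binS (R : comNzRingType) (k j : nat) :
  (j%:R + 1) * 'C(k, j.+1)%:R = (k%:R - j%:R) * 'C(k, j)%:R :> R.
Proof.
have [lejk|ltkj] := leqP j k; last by rewrite !bin_small ?mulr0 // ltnW.
by rewrite natr1 -natrB // -!natrM mul_bin_left.
Qed.

(* Zeilberger certificate: the summand of the recurrence is
   [G k.+1 - G k] with [G k = (2m - 2k + 1) (k - j) C(k, j) w k]. *)
Lemma boros_moll_rec (m j : nat) :
  (m%:R - j%:R) * (m%:R + j%:R + 1) * boros_moll j m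
  - (j%:R + 1) * (2 * m%:R + 1) * boros_moll j.+1 m
  + (j%:R + 1) * (j%:R + 2) * boros_moll j.+2 m = 0.
Proof.
rewrite !boros_mollE.
set S0 := \sum_(_ <= _ < _) _; set S1 := \sum_(_ <= _ < _) _.
set S2 := \sum_(_ <= _ < _) _; set e := _ ^- _.
suff h : (m%:R - j%:R) * (m%:R + j%:R + 1) * S0
  - (j%:R + 1) * (2 * m%:R + 1) * S1 + (j%:R + 1) * (j%:R + 2) * S2 = 0.
  by rewrite -[RHS](mulr0 e) -h; ring.
pose G k := (2 * m%:R - 2 * k%:R + 1) * (k%:R - j%:R) * 'C(k, j)%:R * bm_weight m k.
pose f k := (m%:R - k%:R) * (m%:R + k%:R + 1) * bm_weight m k * 'C(k, j)%:R - G k.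
transitivity (\sum_(0 <= k < m.+1) f k).
  rewrite /S0 /S1 /S2 !mulr_sumr -sumrB -big_split /=.
  apply: eq_bigr => k _; rewrite /f /G.
  have h1 := mul_binS rat k j; have h2 := mul_binS rat k j.+1.
  rewrite -natr1 in h2; move: h1 h2.
  set C0 := 'C(k, j)%:R; set C1 := 'C(k, j.+1)%:R; set C2 := 'C(k, j.+2)%:R => h1 h2.
  have h3 : (j%:R + 1) * (j%:R + 2) * C2 = (k%:R - j%:R - 1) * (k%:R - j%:R) * C0.
    transitivity ((j%:R + 1) * ((j%:R + 1 + 1) * C2)); first by ring.
    by rewrite h2; transitivity ((k%:R - (j%:R + 1)) * ((j%:R + 1) * C1));
      [ring | rewrite h1; ring].
  transitivity (bm_weight m k * ((m%:R - j%:R) * (m%:R + j%:R + 1) * C0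
    - (2 * m%:R + 1) * ((j%:R + 1) * C1) + (j%:R + 1) * (j%:R + 2) * C2)); first by ring.
  by rewrite h1 h3; ring.
(* At [k = m] the factor [m - k] vanishes, so [f m = - G m] cancels the upper end of the telescoped
   sum over [k < m]. *)
rewrite big_nat_recr //= (eq_big_nat _ _ (F2 := fun k => G k.+1 - G k)).
  rewrite telescope_sumr // /f subrr !mul0r add0r.
  have -> : G 0%N = 0 by rewrite /G; case: (j) => [|j']; rewrite ?bin0n /=; ring.
  by ring.
move=> k /andP[_ ltkm]; rewrite /f -bm_weight_rec // /G; congr (_ - _).
have h : (k%:R + 1) * 'C(k, j)%:R = (k.+1%:R - j%:R) * 'C(k.+1, j)%:R :> rat.
  have [lejk|ltkj] := leqP j k.+1.
    by rewrite natr1 -natrB // -!natrM mul_bin_down.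
  by rewrite !bin_small ?mulr0 // ltnW.
transitivity ((2 * m%:R - 2 * k%:R - 1) * bm_weight m k.+1 * ((k%:R + 1) * 'C(k, j)%:R)).
  by ring.
by rewrite h -natr1; ring.
Qed.

(** * From a bound on [c_i] to the claimed inequality *)

(** With [c = 3 t / S], [H = S (2 i + 1 + c)]. The two long factors are the numerator and
    denominator forms; the factor [i n + 2 i + n], [n = m + i], bounds their quotient independently
    of [r]. *)
Lemma ratio_polynomial_ineq (R : realFieldType) (i t r : R) :
  1 <= i -> 0 <= t -> 0 <= r ->
  let m := i + t in let M := t + 1 in
  let S := 2 * i + r in let H := (2 * i + 1) * S + 3 * t in
  i * ((i - 1) * M ^+ 2 * (H - S) ^+ 2
       - (i - 1) * (2 * m + 1) * M * (H - S) * H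
       + i * (M + 1) * (m + i - 1) * H ^+ 2)
  < (i * (m + i) + 2 * i + (m + i)) *
    (M * (H - S) ^+ 2 + i * (2 * i - 1) * H * S + i * M * S ^+ 2).
Proof.
move=> i1 t0 r0 /=; rewrite -subr_gt0.
have i0 : 0 < i by apply: lt_le_trans i1.
have j0 : 0 <= i - 1 by rewrite subr_ge0.
set P := (X in 0 < X).
(* Grouping the negative coefficients into factors [i - 1] leaves only nonnegative terms; [48 i^6]
   gives strictness. *)
have -> : P = 48 * i ^+ 6 + (72 * i ^+ 5
  + (48 * i ^+ 5 + 52 * i ^+ 4 + 84 * i ^+ 3 + 6 * i ^+ 2 * (i - 1)) * t
  + (82 * i ^+ 3 + 18 * i ^+ 2 + 36 * i) * t ^+ 2
  + (12 * i ^+ 2 + 36 * i + 9) * t ^+ 3 + 9 * t ^+ 4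
  + (48 * i ^+ 5 + 72 * i ^+ 4) * r
  + (60 * i ^+ 4 + 28 * i ^+ 3 + 42 * i ^+ 2 + 3 * i * (i - 1)) * t * r
  + 52 * i ^+ 2 * t ^+ 2 * r + 6 * i * t ^+ 3 * r
  + (12 * i ^+ 4 + 18 * i ^+ 3) * r ^+ 2
  + (18 * i ^+ 3 + i ^+ 2) * t * r ^+ 2 + i * t ^+ 2 * r ^+ 2).
  by rewrite /P; ring.
rewrite ltr_wpDr ?mulr_gt0 ?exprn_gt0 //; have := ltW i0 => i0'.
by clear P; move: (i - 1) j0 => j j0; rewrite !(addr_ge0, mulr_ge0, exprn_ge0).
Qed.

(** Compares the intermediate factor with the target. It fails at [i = 1], [t = 0], so [i <= m - 1]
    enters here. *)
Lemma ratio_factor_ineq (R : realFieldType) (i t : R) : 1 <= i -> 1 <= t ->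
  let n := i + t + i in
  (i * n + 2 * i + n) * (n + 2) ^+ 2 <= (i + 2) * (n + 3) ^+ 2 * (n - 1).
Proof.
move=> i1 t1 /=; rewrite -subr_ge0.
have [x [x0 ->]] : exists x, 0 <= x /\ i = x + 1.
  by exists (i - 1); rewrite subr_ge0 subrK.
have [s [s0 ->]] : exists s, 0 <= s /\ t = s + 1.
  by exists (t - 1); rewrite subr_ge0 subrK.
set P := (X in 0 <= X).
have -> : P = 16 + 50 * s + 14 * s ^+ 2 + s ^+ 3
  + (47 + 41 * s + 5 * s ^+ 2) * x + (26 + 8 * s) * x ^+ 2 + 4 * x ^+ 3.
  by rewrite /P; ring.
by rewrite !(addr_ge0, mulr_ge0, exprn_ge0).
Qed.

(** Here [dm, a, b, dp] stand for [d_{i-2}, d_{i-1}, d_i, d_{i+1}]; the last two hypotheses are the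
    recurrence at [i - 2] and [i - 1]. *)
Lemma ratio_bound_of_recurrence (R : realFieldType) (i t r a b dm dp : R) :
  1 <= i -> 1 <= t -> 0 <= r -> 0 < a ->
  let m := i + t in let M := t + 1 in
  let S := 2 * i + r in let H := (2 * i + 1) * S + 3 * t in
  i * H * b = M * (H - S) * a ->
  (M + 1) * (m + i - 1) * dm
    - (i - 1) * (2 * m + 1) * a + (i - 1) * i * b = 0 ->
  M * (m + i) * a - i * (2 * m + 1) * b + i * (i + 1) * dp = 0 ->
  (a ^+ 2 - dm * b) / (b ^+ 2 - a * dp) <
  (i + 1) * (i + 2) * (m + i + 3) ^+ 2 / (M * (M + 1) * (m + i + 2) ^+ 2).
Proof.
move=> i1 t1 r0 a0 m M S H hb hm hp.
have := ratio_polynomial_ineq i1 (le_trans ler01 t1) r0.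
have := ratio_factor_ineq i1 t1; rewrite /= -/m -/M -/S -/H.
set Dq := M * (H - S) ^+ 2 + _ + _; set Nq := (i - 1) * _ * _ - _ + _.
move=> hG hPQ.
have i0 : 0 < i by apply: lt_le_trans i1.
have M0 : 0 < M by rewrite /M; lra.
have S0 : 0 < S by rewrite /S; lra.
have H0 : 0 < H by rewrite /H addr_gt0 ?mulr_gt0 //; lra.
have n0 : 0 < m + i - 1 by rewrite /m; lra.
have Dq0 : 0 < Dq.
  have j0 : 0 < 2 * i - 1 by lra.
  apply: addr_gt0; last by rewrite !mulr_gt0 ?exprn_gt0.
  by apply: ltr_wpDl; rewrite ?mulr_gt0 // mulr_ge0 ?sqr_ge0 // ltW.
have bE : b = M * (H - S) * a / (i * H).
  by rewrite -hb [i * H * b]mulrC mulfK // gt_eqF // mulr_gt0.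
have dmE : dm = ((i - 1) * (2 * m + 1) * a - (i - 1) * i * b) / ((M + 1) * (m + i - 1)).
  apply: (canRL (mulfK _)); first by rewrite gt_eqF // mulr_gt0 // addr_gt0.
  by rewrite mulrC; apply/eqP; rewrite -subr_eq0 -[X in _ == X]hm; apply/eqP; ring.
have dpE : dp = (i * (2 * m + 1) * b - M * (m + i) * a) / (i * (i + 1)).
  apply: (canRL (mulfK _)); first by rewrite gt_eqF // mulr_gt0 // addr_gt0.
  by rewrite mulrC; apply/eqP; rewrite -subr_eq0 -[X in _ == X]hp; apply/eqP; ring.
have H1 : H != 0 by rewrite gt_eqF.
have i2 : i != 0 by rewrite gt_eqF.
have i3 : i + 1 != 0 by rewrite gt_eqF // addr_gt0.
have M1 : M != 0 by rewrite gt_eqF.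
have M2 : M + 1 != 0 by rewrite gt_eqF // addr_gt0.
have n1 : m + i - 1 != 0 by rewrite gt_eqF.
have n2 : 0 < m + i + 2 by lra.
(* This identity needs no relation between [H] and [S], so both are generalized; [Dq > 0] then gives
   the sign of the denominator. *)
have DE : b ^+ 2 - a * dp = a ^+ 2 * M / (i ^+ 2 * (i + 1) * H ^+ 2) * Dq.
  rewrite dpE bE /Dq; move: (H) (S) H1 => h s h1; rewrite /m /M.
  by field; rewrite ?h1 ?i2 ?i3.
have NE : a ^+ 2 - dm * b = a ^+ 2 / (i * (M + 1) * (m + i - 1) * H ^+ 2) * Nq.
  rewrite dmE bE /Nq; move: (H) (S) H1 => h s h1.
  by field; rewrite ?h1 ?i2 ?M2 ?n1.
have c0 : 0 < a ^+ 2 / (i ^+ 2 * (M + 1) * (m + i - 1) * (m + i + 2) ^+ 2 * H ^+ 2).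
  by rewrite divr_gt0 ?mulr_gt0 ?exprn_gt0 // addr_gt0.
rewrite ltr_pdivrMr; last first.
  by rewrite DE !mulr_gt0 ?invr_gt0 ?mulr_gt0 ?exprn_gt0 // addr_gt0.
rewrite DE NE -subr_gt0; set P := (X in 0 < X).
have -> : P = a ^+ 2 / (i ^+ 2 * (M + 1) * (m + i - 1) * (m + i + 2) ^+ 2 * H ^+ 2) *
    ((i + 2) * (m + i + 3) ^+ 2 * (m + i - 1) * Dq - (m + i + 2) ^+ 2 * (i * Nq)).
  rewrite /P; move: (H) (Dq) (Nq) H1 => h D N h1.
  by field; rewrite ?h1 ?i2 ?i3 ?M1 ?M2 ?n1 ?gt_eqF.
rewrite mulr_gt0 // subr_gt0.
apply: (@lt_le_trans _ _ ((i * (m + i) + 2 * i + (m + i)) * (m + i + 2) ^+ 2 * Dq)).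
  by rewrite [X in _ < X]mulrAC [X in X < _]mulrC ltr_pM2r ?exprn_gt0.
by rewrite ler_pM2r.
Qed.

(** * Bounds on consecutive quotients *)

(* Backward induction on [i = j + 1 = m - t] through the three-term recurrence,
   which for [c = 3 t / S] becomes
   [c_i = (m - i) (3 + c_{i+1}) / (m + i + 3 + c_{i+1})]. *)
Lemma boros_moll_ratio (m t j : nat) : m = (j + t).+1 ->
  exists2 r : rat, 0 <= r &
    let i := j%:R + 1 in let S := 2 * i + r in
    let H := (2 * i + 1) * S + 3 * t%:R in
    i * H * boros_moll j.+1 m = (t%:R + 1) * (H - S) * boros_moll j m.
Proof.
elim: t j => [|t IH] j mE.
  (* For [t = 0], [c_m = 0] and [S] cancels; [d_{m+1} = 0] leaves a two-term relation. *)
  exists 0 => //=.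
  have := boros_moll_rec m j; rewrite [in boros_moll j.+2 m]mE addn0.
  rewrite boros_moll_gtm.
  rewrite (_ : m%:R = j%:R + 1 :> rat); last by rewrite mE addn0 natr1.
  move: (boros_moll j m) (boros_moll j.+1 m) => a b h.
  have {}h : (j%:R + 1) * (2 * (j%:R + 1) + 1) * b = (2 * j%:R + 2) * a.
    by apply/eqP; rewrite eq_sym -subr_eq0 -[X in _ == X]h; apply/eqP; ring.
  transitivity (2 * (j%:R + 1) * ((j%:R + 1) * (2 * (j%:R + 1) + 1) * b)).
    by ring.
  by rewrite h; ring.
have [|r r0 /=] := IH j.+1; first by rewrite mE addSnnS.
have := boros_moll_rec m j.
rewrite (_ : m%:R = j%:R + t%:R + 2 :> rat); last first.
  by rewrite mE -!natr1 natrD -natr1; ring.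
rewrite -[j.+1%:R]natr1 -[t.+1%:R]natr1.
have := ler0n rat j; have := ler0n rat t.
have : 0 < boros_moll j.+1 m by apply: boros_moll_gt0; lia.
move: (j%:R) (t%:R) => x s.
move: (boros_moll j m) (boros_moll j.+1 m) (boros_moll j.+2 m) => a b c.
move=> b0 s0 x0 h1 h2.
have Ss : 0 < 2 * (x + 1 + 1) + r + s by lra.
(* Obtained by solving [c_i = 3 (s + 1) / (2 (x + 1) + r')] for [r'], with [c_{i+1} = 3 s / S]; the
   terms [2 x s] cancel. *)
exists ((s * (r + 5) + 4 * (2 * (x + 1 + 1) + r)) / (2 * (x + 1 + 1) + r + s)).
  by rewrite divr_ge0 ?(ltW Ss) // addr_ge0 ?mulr_ge0 //; lra.
set S := 2 * (x + 1 + 1) + r; set H := (2 * (x + 1 + 1) + 1) * S + 3 * s.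
(* Eliminates [c] between the recurrence [h1] and the induction hypothesis [h2]. *)
have key : (x + 1) * ((2 * x + s + 4) * H + (s + 1) * S) * b
           = (s + 2) * (2 * x + s + 3) * H * a.
  move: h2; rewrite -/S -/H => /eqP; rewrite -subr_eq0 => /eqP h2.
  apply/eqP; rewrite eq_sym -subr_eq0 -[X in _ == X](mulr0 H) -h1.
  rewrite -[X in _ == X]subr0 -[X in _ == _ - X](mulr0 (x + 1)) -h2.
  by apply/eqP; ring.
(* Divided by [S + s], the factors [(2 x + s + 4) H + (s + 1) S] and [(2 x + s + 3) H] become the
   new [H] and [H - S]. *)
transitivity ((x + 1) * ((2 * x + s + 4) * H + (s + 1) * S) * b / (S + s)).
  by rewrite /H /S; field; rewrite gt_eqF.
by rewrite key /H /S; field; rewrite gt_eqF.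
Qed.

(** * Specialization with [i = j + 1] and [m - i = t + 1] *)

Theorem theorem1p6 (m : nat) (i : int) (hi1 : 1 <= i) (him : i <= m%:Z - 1) :
  (boros_moll (i - 1) m ^+ 2 - boros_moll (i - 2) m * boros_moll i m)
    / (boros_moll i m ^+ 2 - boros_moll (i - 1) m * boros_moll (i + 1) m)
  < ((i + 1) * (i + 2) * (m%:Z + i + 3) ^+ 2)%:~R
    / ((m%:Z + 1 - i) * (m%:Z + 2 - i) * (m%:Z + i + 2) ^+ 2)%:~R.
Proof.
have [j [t [iE mE]]] : exists j t : nat, i = j.+1%:Z /\ m = (j + t.+1).+1.
  by exists `|i - 1|%N, (m - `|i - 1| - 2)%N; lia.
rewrite {i}iE in hi1 him *.
rewrite (_ : j.+1%:Z - 1 = j); last lia.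
rewrite (_ : j.+1%:Z + 1 = j.+2); last lia.
have [r r0 hb] := boros_moll_ratio mE.
have hm : (m%:R - j%:R + 1) * (m%:R + j%:R) * boros_moll (j.+1%:Z - 2) m
    - j%:R * (2 * m%:R + 1) * boros_moll j m
    + j%:R * (j%:R + 1) * boros_moll j.+1 m = 0.
  (* For [i = 1] the recurrence at index [-1] holds because [d_{-1} = 0] and the other two
     coefficients contain the factor [j = 0]. *)
  case: (j) => [|k]; first by rewrite /boros_moll /=; ring.
  rewrite (_ : k.+2%:Z - 2 = k); last lia.
  by rewrite -[RHS](boros_moll_rec m k) -[k.+1%:R]natr1; ring.
have hp := boros_moll_rec m j.
have a0 : 0 < boros_moll j m by apply: boros_moll_gt0; lia.
have mR : m%:R = j%:R + 1 + t.+1%:R :> rat.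
  by rewrite mE -natr1 natrD; ring.
rewrite mR in hm hp.
have i1 : 1 <= j%:R + 1 :> rat by rewrite lerDr.
have t1 : 1 <= t.+1%:R :> rat by rewrite ler1n.
have := ratio_bound_of_recurrence i1 t1 r0 a0 hb.
move=> /(_ (boros_moll (j.+1%:Z - 2) m) (boros_moll j.+2 m)) h.
apply: lt_le_trans (h _ _) _.
- by rewrite -[RHS]hm; ring.
- by rewrite -[RHS]hp; ring.
rewrite le_eqVlt; apply/orP; left; apply/eqP; rewrite mE.
have e : (((j + t.+1).+1)%:Z = j%:Z + 1 + t.+1%:Z)%R by lia.
rewrite e (_ : j.+1%:Z = j%:Z + 1); last lia.
by congr (_ / _);
  rewrite !(rmorphM, rmorphXn, rmorphD, rmorphB) /=; ring.
Qed.
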